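(* Let $\mathbb{F}_q$ be the finite field of order $q$, let $m_1,\dots,m_\ell$ be positive integers coprime to $q$, let $n=m_1+\cdots+m_\ell$, and let $\Lambda=(\lambda_1,\dots,\lambda_\ell)$ with all $\lambda_i\in\mathbb{F}_q\setminus\{0\}$. Let $\mathcal{C}=\langle a_1(x),\dots,a_\rho(x)\rangle$ be a nonzero $\rho$-generator $\Lambda$-multi-twisted code of length $n$ over $\mathbb{F}_q$, where $a_\kappa(x)=(a_{\kappa,1}(x),\dots,a_{\kappa,\ell}(x))$ for $1\le\kappa\le\rho$. Then the minimum Hamming distance $d_{\min}(\mathcal{C})$ of $\mathcal{C}$ satisfies $$d_{\min}(\mathcal{C})\ge\min_{1\le i\le\ell}(b_i+1),$$ where, for each $i$, $b_i$ is the maximum number of consecutive exponents of zeros of $\gcd(a_{1,i}(x),a_{2,i}(x),\dots,a_{\rho,i}(x),x^{m_i}-\lambda_i)$.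
   Context: Let $V=\prod_{i=1}^{\ell}V_i$ with $V_i=\mathbb{F}_q[x]/\langle x^{m_i}-\lambda_i\rangle$, an $\mathbb{F}_q[x]$-module; $\mathbb{F}_q^n$ is identified with $V$ by sending $(a_{1,0},\dots,a_{1,m_1-1};\dots;a_{\ell,0},\dots,a_{\ell,m_\ell-1})$ to $(a_1(x),\dots,a_\ell(x))$ with $a_i(x)=\sum_{j=0}^{m_i-1}a_{i,j}x^j$. A $\Lambda$-multi-twisted code of length $n$ over $\mathbb{F}_q$ is an $\mathbb{F}_q[x]$-submodule of $V$. It is called a $\rho$-generator code if $\rho$ is the smallest positive integer such that there are $\rho$ codewords $a_1(x),\dots,a_\rho(x)\in\mathcal{C}$ generating $\mathcal{C}$ as an $\mathbb{F}_q[x]$-module; one writes $\mathcal{C}=\langle a_1(x),\dots,a_\rho(x)\rangle$. Exponents of zeros: for each $i$ fix, in an algebraic closure of $\mathbb{F}_q$, an element $\delta_i$ with $\delta_i^{m_i}=\lambda_i$ and a primitive $m_i$-th root of unity $\xi_i$; the zeros of $x^{m_i}-\lambda_i$ are $\delta_i\xi_i^j$, $0\le j\le m_i-1$, and the exponent of the zero $\delta_i\xi_i^j$ is $j$ (modulo $m_i$). For a divisor $w(x)$ of $x^{m_i}-\lambda_i$, the maximum number of consecutive exponents of zeros of $w(x)$ is the largest integer $b$ with $0\le b\le m_i$ for which there is an integer $j_0$ such that $\delta_i\xi_i^{j_0},\delta_i\xi_i^{j_0+1},\dots,\delta_i\xi_i^{j_0+b-1}$ are all zeros of $w(x)$. 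*)

(* Defs.v *)
From HB Require Import structures.
From mathcomp Require Import all_boot all_order all_algebra.

Set Implicit Arguments.
Unset Strict Implicit.
Unset Printing Implicit Defensive.

Import GRing.Theory.

Local Open Scope ring_scope.

(* [{poly %/ h}] is F[x]/<h> for h monic of positive degree, and F[x]/<x>     *)
(* otherwise: [mt_block] is F[x]/<x^m - c> only when 0 < m. Its elements      *)
(* coerce to their representatives of degree < m.                             *)
Notation mt_block m c := {poly %/ 'X^m - c%:P}.

Definition mt_space (F : finFieldType) (l : nat) (m : 'I_l -> nat)
    (lam : 'I_l -> F) : Type :=
  {dffun forall i : 'I_l, mt_block (m i) (lam i)}.

Section MultiTwistedSpace.
Variables (F : finFieldType) (l : nat) (m : 'I_l -> nat) (lam : 'I_l -> F).
Local Notation V := (mt_space m lam).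
Implicit Types (u v w : V) (f g : {poly F}).

HB.instance Definition _ := Finite.copy V
  {dffun forall i : 'I_l, mt_block (m i) (lam i)}.

Definition mt_zero : V := [ffun i => 0 : mt_block (m i) (lam i)].
Definition mt_opp u : V := [ffun i => - u i : mt_block (m i) (lam i)].
Definition mt_add u v : V := [ffun i => u i + v i : mt_block (m i) (lam i)].
Definition mt_scale f u : V :=
  [ffun i => in_qpoly ('X^(m i) - (lam i)%:P) f * u i].

Fact mt_addA : associative mt_add.
Proof. by move=> u v w; apply/ffunP=> i; rewrite !ffunE; exact: addrA. Qed.
Fact mt_addC : commutative mt_add.
Proof. by move=> u v; apply/ffunP=> i; rewrite !ffunE; exact: addrC. Qed.
Fact mt_add0 : left_id mt_zero mt_add.
Proof. by move=> u; apply/ffunP=> i; rewrite !ffunE; exact: add0r. Qed.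
Fact mt_addN : left_inverse mt_zero mt_opp mt_add.
Proof. by move=> u; apply/ffunP=> i; rewrite !ffunE; exact: addNr. Qed.

HB.instance Definition _ :=
  GRing.isZmodule.Build V mt_addA mt_addC mt_add0 mt_addN.

Fact mt_scaleA f g u : mt_scale f (mt_scale g u) = mt_scale (f * g) u.
Proof. by apply/ffunP=> i; rewrite !ffunE rmorphM mulrA. Qed.
Fact mt_scale1 : left_id 1 mt_scale.
Proof. by move=> u; apply/ffunP=> i; rewrite !ffunE rmorph1 mul1r. Qed.
Fact mt_scaleDr : right_distributive mt_scale +%R.
Proof. by move=> f u v; apply/ffunP=> i; rewrite !ffunE; exact: mulrDr. Qed.
Fact mt_scaleDl u : {morph mt_scale^~ u : f g / f + g}.
Proof. by move=> f g; apply/ffunP=> i; rewrite !ffunE rmorphD mulrDl. Qed.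

HB.instance Definition _ := GRing.Zmodule_isLmodule.Build {poly F} V
  mt_scaleA mt_scale1 mt_scaleDr mt_scaleDl.

Definition mt_of_word (x : 'rV[F]_(\sum_i m i)) : V :=
  [ffun i => in_qpoly ('X^(m i) - (lam i)%:P) (rVpoly (submxrow x i))].

Definition mt_code (C : {set V}) : Prop := submod_closed C.

Definition generates (rho : nat) (a : 'I_rho -> V) (C : {set V}) : Prop :=
  forall c, c \in C <->
    exists f : 'I_rho -> {poly F}, c = \sum_(k < rho) f k *: a k.

Definition generator_code (rho : nat) (C : {set V}) : Prop :=
  [/\ (0 < rho)%N,
      exists a : 'I_rho -> V, generates a C
    & forall (r : nat) (a : 'I_r -> V),
        (0 < r)%N -> generates a C -> (rho <= r)%N].

Definition mt_gcd (rho : nat) (a : 'I_rho -> V) (i : 'I_l) : {poly F} :=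
  \big[@gcdp F/'X^(m i) - (lam i)%:P]_(k < rho) (a k i : {poly F}).

End MultiTwistedSpace.

Definition hamming_dist (F : finFieldType) (n : nat) (x y : 'rV[F]_n) : nat :=
  #|[set j | x 0 j != y 0 j]|.

(* The default n bounds all distances, so it does not affect the minimum      *)
(* as soon as D has two distinct words.                                       *)
Definition min_dist (F : finFieldType) (n : nat) (D : {set 'rV[F]_n}) : nat :=
  \big[minn/n]_(p : 'rV[F]_n * 'rV[F]_n
                  | [&& p.1 \in D, p.2 \in D & p.1 != p.2])
     hamming_dist p.1 p.2.

Definition has_consecutive_zeros (K : fieldType) (delta xi : K)
    (w : {poly K}) (b : nat) : Prop :=
  exists j0 : int, forall k : nat, (k < b)%N ->
    root w (delta * xi ^ (j0 + k%:Z)).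

Definition max_consecutive_zeros (K : fieldType) (m : nat) (delta xi : K)
    (w : {poly K}) (b : nat) : Prop :=
  [/\ (b <= m)%N, has_consecutive_zeros delta xi w b
    & forall b' : nat, (b' <= m)%N ->
        has_consecutive_zeros delta xi w b' -> (b' <= b)%N].

(* Main.v *)
(* Two distinct codewords differ in some block i, and the i-th component of   *)
(* their difference is a nonzero multiple of the gcd g_i modulo               *)
(* x^(m_i) - lam_i, itself a multiple of g_i. It thus inherits the b_i        *)
(* consecutive zeros of g_i, and the BCH bound makes the weight of that       *)
(* single block exceed b_i.                                                   *)
Require Import Defs.
From mathcomp Require Import all_boot all_order all_algebra.

Set Implicit Arguments.
Unset Strict Implicit.
Unset Printing Implicit Defensive.

Import GRing.Theory.

Local Open Scope ring_scope.

(** Everything happens in one block where two words differ. [mt_gcd_dvd_span] gives that component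
    of the difference all zeros of the gcd, [bch_bound] bounds its weight from below, and
    [card_submxrow_neq0] passes to the whole word. Which block it is cannot be prescribed, hence the
    minimum over [i]. *)

Lemma bch_bound_geometric (K : fieldType) (m b : nat) (beta xi : K)
    (p : {poly K}) :
  m.-primitive_root xi -> beta != 0 -> p != 0 -> (size p <= m)%N ->
  (forall k, (k < b)%N -> root p (beta * xi ^+ k)) ->
  (b < #|[set j : 'I_m | (p`_j != 0)%R]|)%N.
Proof.
move=> xi_prim beta0 p0 sz_p p_root; rewrite ltnNge.
set S := [set j | _]; apply/negP => le_Sb.
(* The zeros say that the weights p_j beta^j at the nodes xi^j annihilate all *)
(* h of degree < b; testing on an h that vanishes on all of S but one point   *)
(* replaces the Vandermonde determinant.                                      *)
have sum0 (h : {poly K}) : (size h <= b)%N ->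
    \sum_(j < m) p`_j * beta ^+ j * h.[xi ^+ j] = 0.
  move=> sz_h; under eq_bigr do rewrite (horner_coef_wide _ sz_h) mulr_sumr.
  rewrite exchange_big big1 // => k _ /=.
  have /rootP := p_root k (ltn_ord k); rewrite (horner_coef_wide _ sz_p) => E.
  transitivity (h`_k * 0); last exact: mulr0.
  rewrite -[X in _ * X]E mulr_sumr; apply: eq_bigr => j _.
  by rewrite exprMn exprAC mulrCA !mulrA.
have [j1 Sj1] : exists j1, j1 \in S.
  have lt_m : ((size p).-1 < m)%N by rewrite prednK // size_poly_gt0.
  by exists (Ordinal lt_m); rewrite inE -lead_coefE lead_coef_eq0.
(* Dropping [j1] offsets the one by which size exceeds degree, so [h] has size exactly [#|S|], at
   most [b]. *)
pose h := \prod_(j in S :\ j1) ('X - (xi ^+ j)%:P).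
have sz_h : (size h <= b)%N.
  rewrite /h -big_enum size_prod_XsubC -cardE.
  by rewrite (cardsD1 j1) Sj1 in le_Sb.
have := sum0 h sz_h; rewrite (bigD1 j1) //= big1 => [|j neq_j]; last first.
  have [Sj|] := boolP (j \in S).
    have S'j : j \in S :\ j1 by rewrite in_setD1 neq_j.
    by rewrite horner_prod (bigD1 j S'j) /= hornerXsubC subrr mul0r mulr0.
  by rewrite inE negbK => /eqP->; rewrite !mul0r.
(* Only the term at [j1] survives; it is nonzero because the nodes [xi ^+ j] are distinct, [xi]
   being primitive. *)
move/eqP; rewrite addr0 !mulf_eq0 expf_eq0 (negPf beta0) andbF orbF.
move: (Sj1); rewrite inE => /negPf -> /=.
rewrite horner_prod => /prodf_eq0[j]; rewrite 2!inE => /andP[neq_j _].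
rewrite hornerXsubC subr_eq0 (eq_prim_root_expr xi_prim) !modn_small //.
by move/eqP/val_inj => E; rewrite E eqxx in neq_j.
Qed.

(** The start [j0], possibly negative, is absorbed into [beta := delta * xi ^ j0]. *)
Lemma bch_bound (K : fieldType) (m b : nat) (delta xi : K) (p : {poly K}) :
  m.-primitive_root xi -> delta != 0 -> p != 0 -> (size p <= m)%N ->
  has_consecutive_zeros delta xi p b ->
  (b < #|[set j : 'I_m | (p`_j != 0)%R]|)%N.
Proof.
move=> xi_prim delta0 p0 sz_p [j0 p_root].
have xi0 : xi != 0.
  by rewrite -unitfE -(unitrX_pos _ (prim_order_gt0 xi_prim))
             (prim_expr_order xi_prim) unitr1.
apply: (bch_bound_geometric (beta := delta * xi ^ j0)) xi_prim _ p0 sz_p _.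
  by rewrite mulf_neq0 // expfz_neq0.
by move=> k /p_root; rewrite expfzDr // mulrA.
Qed.

Section Components.
Variables (F : finFieldType) (l : nat) (m : 'I_l -> nat) (lam : 'I_l -> F).
Local Notation V := (mt_space m lam).

Lemma mt_gcd_dvd rho (a : 'I_rho -> V) i k :
  mt_gcd a i %| (a k i : {poly F}).
Proof.
rewrite /mt_gcd; have := mem_index_enum k.
elim: (index_enum _) => //= k' r IHr; rewrite inE big_cons => /predU1P[->|/IHr].
  exact: dvdp_gcdl.
by apply: dvdp_trans; apply: dvdp_gcdr.
Qed.

Lemma mt_gcd_dvd_modulus rho (a : 'I_rho -> V) i :
  mt_gcd a i %| 'X^(m i) - (lam i)%:P.
Proof.
rewrite /mt_gcd; elim/big_rec: _ => [|k g _]; first exact: dvdpp.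
by apply: dvdp_trans; apply: dvdp_gcdr.
Qed.

Lemma mk_monic_modulus i :
  (0 < m i)%N -> mk_monic ('X^(m i) - (lam i)%:P) = 'X^(m i) - (lam i)%:P.
Proof.
by move=> m0; rewrite /mk_monic size_XnsubC // monicXnsubC // ltnS m0.
Qed.

Lemma mt_sumE rho (u : 'I_rho -> V) i : (\sum_k u k) i = \sum_k u k i.
Proof. by elim/big_rec2: _ => [|k x y _ <-]; rewrite ffunE. Qed.

(** Taking remainders preserves divisibility by the gcd because the gcd also divides the modulus. *)
Lemma mt_gcd_dvd_span rho (a : 'I_rho -> V) (f : 'I_rho -> {poly F}) i :
  (0 < m i)%N -> mt_gcd a i %| ((\sum_k f k *: a k) i : {poly F}).
Proof.
move=> m0; rewrite mt_sumE raddf_sum /=; elim/big_ind: _ => [|x y|k _].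
- exact: dvdp0.
- exact: dvdp_add.
rewrite ffunE poly_of_qpolyM -Pdiv.IdomainMonic.modpE ?monic_mk_monic //.
rewrite -dvdp_mod; last by rewrite mk_monic_modulus // mt_gcd_dvd_modulus.
by rewrite dvdp_mull ?mt_gcd_dvd.
Qed.

Lemma mt_of_wordE (x : 'rV[F]_(\sum_i m i)) i :
  (0 < m i)%N -> (mt_of_word lam x i : {poly F}) = rVpoly (submxrow x i).
Proof.
move=> m0; rewrite ffunE in_qpoly_small // mk_monic_modulus // size_XnsubC //.
exact: size_poly.
Qed.

Lemma mt_of_wordB : {morph @mt_of_word F l m lam : x y / x - y}.
Proof.
by move=> x y; apply/ffunP => i; rewrite !ffunE submxrowB !raddfB.
Qed.

Lemma mt_of_word_surj (m_gt0 : forall i, (0 < m i)%N) (c : V) :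
  exists x, mt_of_word lam x = c.
Proof.
exists (\mxrow_i poly_rV (c i : {poly F})); apply/ffunP => i; apply: val_inj.
rewrite /= mt_of_wordE // mxrowK poly_rV_K //.
have := size_mk_monic (c i).
by rewrite [X in (_ < size (polyseq X))%N -> _]mk_monic_modulus // size_XnsubC.
Qed.

End Components.

Lemma card_submxrow_neq0 (F : fieldType) l (m : 'I_l -> nat)
    (d : 'rV[F]_(\sum_i m i)) i :
  (#|[set j : 'I_(m i) | (submxrow d i 0 j != 0)%R]|
     <= #|[set j | (d 0 j != 0)%R]|)%N.
Proof.
have Rank_inj : injective (@tagnat.Rank _ m i).
  by move=> j k /(congr1 val)/eqP; rewrite tagnat.eq_Rank eqxx => /eqP/val_inj.
rewrite -(card_imset _ Rank_inj); apply/subset_leq_card/subsetP => j.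
by case/imsetP => k; rewrite inE !mxE => dk ->; rewrite inE.
Qed.

(* (K, iota) is an arbitrary algebraic closure of F = F_q. The default value  *)
(* n + 1 of the minimum over i bounds all b i + 1; l > 0 since C is nonzero.  *)
Theorem theorem5p3 (F : finFieldType) (K : closedFieldType)
    (iota : {rmorphism F -> K}) (iota_alg : integralRange iota)
    (l : nat) (m : 'I_l -> nat) (lam : 'I_l -> F)
    (m_gt0 : forall i, (0 < m i)%N)
    (m_coprime : forall i, coprime (m i) #|F|)
    (lam_neq0 : forall i, lam i != 0)
    (delta xi : 'I_l -> K)
    (delta_root : forall i, delta i ^+ m i = iota (lam i))
    (xi_prim : forall i, (m i).-primitive_root (xi i))
    (C : {set mt_space m lam}) (rho : nat) (a : 'I_rho -> mt_space m lam)
    (C_code : mt_code C)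
    (C_neq0 : exists2 c, c \in C & c != 0)
    (C_rho : generator_code rho C)
    (a_gen : generates a C)
    (b : 'I_l -> nat)
    (b_max : forall i, max_consecutive_zeros (m i) (delta i) (xi i)
                         (map_poly iota (mt_gcd a i)) (b i)) :
  (\big[minn/(\sum_i m i).+1]_(i < l) (b i).+1
     <= min_dist (@mt_of_word F l m lam @^-1: C))%N.
Proof.
have min_le (i : 'I_l) (k : nat) : (b i < k)%N ->
    (\big[minn/(\sum_i m i).+1]_(i < l) (b i).+1 <= k)%N.
  move=> lt_bk; rewrite -minEnat -leEnat.
  exact: (Order.TotalTheory.bigmin_inf i).
have [Czero Clin] := C_code.
have CB u v : u \in C -> v \in C -> u - v \in C.
  by move=> Cu Cv; rewrite addrC -scaleN1r Clin.
set D := _ @^-1: C.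
have le_dist x y : x \in D -> y \in D -> x != y ->
    (\big[minn/(\sum_i m i).+1]_(i < l) (b i).+1 <= hamming_dist x y)%N.
  rewrite !inE => Dx Dy neq_xy.
  have [i di0] : exists i, submxrow (x - y) i != 0.
    apply/existsP; apply: contraR neq_xy; rewrite negb_exists => /forallP d0.
    rewrite -subr_eq0; apply/eqP/mxrowP => i.
    by apply/eqP; rewrite submxrow0 -[_ == _]negbK.
  apply: (min_le i).
  have := CB _ _ Dx Dy; rewrite -mt_of_wordB => /a_gen[f Ef].
  have dvd_p : mt_gcd a i %| rVpoly (submxrow (x - y) i).
    by rewrite -(mt_of_wordE lam) // Ef mt_gcd_dvd_span.
  have delta0 : delta i != 0.
    apply: contraNneq (lam_neq0 i) => delta0; rewrite -(fmorph_eq0 iota).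
    by rewrite -delta_root delta0 expr0n eqn0Ngt m_gt0.
  have [_ [j0 zeros] _] := b_max i.
  have := @bch_bound _ _ (b i) _ _ (map_poly iota (rVpoly (submxrow (x - y) i)))
    (xi_prim i) delta0.
  rewrite map_poly_eq0 size_map_poly => /(_ _ (size_poly _ _)) lt_b.
  apply: leq_trans (lt_b _ _) _.
  - by apply: contra_neq di0 => p0; rewrite -[LHS]rVpolyK p0 linear0.
  - exists j0 => k /zeros; rewrite -!dvdp_XsubCl => /dvdp_trans; apply.
    by rewrite dvdp_map.
  apply: leq_trans (leq_trans (card_submxrow_neq0 (x - y) i) _).
  (* Weights over [K] and over [F] agree since [iota] is injective. *)
  - apply/subset_leq_card/subsetP => j; rewrite !inE coef_map fmorph_eq0.
    by rewrite coef_rVpoly_ord.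
  by apply/subset_leq_card/subsetP => j; rewrite !inE !mxE subr_eq0.
(* The default [n] of [min_dist] must also meet the bound: a nonzero codeword and zero come from
   distinct words, at distance at most [n]. *)
have [c Cc c0] := C_neq0.
have [x Ex] := mt_of_word_surj m_gt0 c.
have [y Ey] := mt_of_word_surj m_gt0 (0 : mt_space m lam).
have Dx : x \in D by rewrite inE Ex.
have Dy : y \in D by rewrite inE Ey.
have neq_xy : x != y by apply: contraNneq c0 => E; rewrite -Ex E Ey.
rewrite /min_dist -minEnat -leEnat.
apply/Order.TotalTheory.bigmin_geP; split=> [|[u v] /and3P[Du Dv neq_uv]].
  apply: leq_trans (le_dist x y Dx Dy neq_xy) _.
  by rewrite -[leqRHS]card_ord max_card.
exact: le_dist.
Qed.
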